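(* Assume Church's Thesis. Let $K$ be an arbitrary first order theory, $T$ a finite set of well-formed formulas of $K$, and $A$, $B$ closed well-formed formulas of $K$. If $(T, A) \vdash_K B$, then $T \vdash_K A \Rightarrow B$; and this holds even if the premise $(T, A) \vdash_K B$ is established meta-mathematically, assuming the consistency of $(T, A)$, but a deduction $\langle B_1, B_2, \dots, B_n\rangle$ of $B$ from $(T, A)$ in $K$ is not known explicitly.
   Context: First order theories are classical, as in Mendelson's ''Introduction to Mathematical Logic'': $K$ has the usual logical axioms, possibly further proper axioms, and the rules of inference modus ponens and generalisation. For a set $\Gamma$ of well-formed formulas, $\Gamma \vdash_K B$ means that there is a deduction of $B$ from $\Gamma$ in $K$, i.e. a finite sequence $\langle B_1, \dots, B_n\rangle$ of well-formed formulas such that $B_n$ is $B$ and, for each $i$, either $B_i$ is an axiom of $K$, or $B_i$ is in $\Gamma$, or $B_i$ is a direct consequence by some rule of inference of $K$ of some of the preceding formulas in the sequence. $(T, A)$ denotes the set $T \cup \{A\}$. Church's Thesis: a number-theoretic function is effectively computable if, and only if, it is recursive. *)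

(* Defs.v *)
From Stdlib Require List.
From mathcomp Require Import all_boot.
From mathcomp Require Import boolp classical_sets cardinality.
Set Implicit Arguments.
Unset Strict Implicit.
Unset Printing Implicit Defensive.
Local Open Scope classical_set_scope.

(* Mendelson, Introduction to Mathematical Logic, is followed throughout.     *)
(* Each kind of symbol is finite or denumerable; letters take at least one    *)
(* argument, and there is at least one predicate letter.                      *)
Record language := Language {
  constant : countType;
  fletter : countType;
  farity : fletter -> nat;
  farity_gt0 : forall f, 0 < farity f;
  pletter : countType;
  parity : pletter -> nat;
  parity_gt0 : forall P, 0 < parity P;
  some_pletter : inhabited pletter }.

Inductive term (L : language) : Type :=
| Var of nat
| Const of constant L
| App (f : fletter L) of {ffun 'I_(farity f) -> term L}.

Arguments Var {L}.

Inductive wff (L : language) : Type :=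
| Atom (P : pletter L) of {ffun 'I_(parity P) -> term L}
| Neg of wff L
| Imp of wff L & wff L
| All of nat & wff L.

Fixpoint occurs (L : language) (x : nat) (t : term L) : bool :=
  match t with
  | Var y => x == y
  | Const _ => false
  | App f ts => [exists i, occurs x (ts i)]
  end.

Fixpoint free (L : language) (x : nat) (B : wff L) : bool :=
  match B with
  | Atom P ts => [exists i, occurs x (ts i)]
  | Neg C => free x C
  | Imp C D => free x C || free x D
  | All y C => (x != y) && free x C
  end.

Definition closed_wff (L : language) (B : wff L) : Prop := forall x, ~~ free x B.

Fixpoint tsubst (L : language) (x : nat) (s t : term L) : term L :=
  match t with
  | Var y => if x == y then s else Var y
  | Const c => Const c
  | App f ts => App [ffun i => tsubst x s (ts i)]
  end.

(* Literal replacement of the free occurrences of x; capture is excluded in   *)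
(* the axioms by free_for.                                                    *)
Fixpoint subst (L : language) (x : nat) (s : term L) (B : wff L) : wff L :=
  match B with
  | Atom P ts => Atom [ffun i => tsubst x s (ts i)]
  | Neg C => Neg (subst x s C)
  | Imp C D => Imp (subst x s C) (subst x s D)
  | All y C => if x == y then All y C else All y (subst x s C)
  end.

(* No free occurrence of x in B lies in the scope of a quantifier binding a   *)
(* variable of s.                                                             *)
Fixpoint free_for (L : language) (s : term L) (x : nat) (B : wff L) : bool :=
  match B with
  | Atom _ _ => true
  | Neg C => free_for s x C
  | Imp C D => free_for s x C && free_for s x D
  | All y C => ~~ free x (All y C) || ~~ occurs y s && free_for s x C
  end.

Inductive logical_axiom (L : language) : wff L -> Prop :=
| logical_axiom1 B C : logical_axiom (Imp B (Imp C B))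
| logical_axiom2 B C D : logical_axiom
    (Imp (Imp B (Imp C D)) (Imp (Imp B C) (Imp B D)))
| logical_axiom3 B C : logical_axiom
    (Imp (Imp (Neg C) (Neg B)) (Imp (Imp (Neg C) B) C))
| logical_axiom4 x s B : free_for s x B ->
    logical_axiom (Imp (All x B) (subst x s B))
| logical_axiom5 x B C : ~~ free x B ->
    logical_axiom (Imp (All x (Imp B C)) (Imp B (All x C))).

Record theory := Theory {
  lang :> language;
  proper_axiom : set (wff lang) }.

Definition axiom (K : theory) (B : wff K) : Prop :=
  logical_axiom B \/ proper_axiom B.

(* Modus ponens and generalisation, without restriction on the latter.        *)
Inductive direct_consequence (L : language) (S : set (wff L)) : wff L -> Prop :=
| modus_ponens B C : S B -> S (Imp B C) -> direct_consequence S C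
| generalisation x B : S B -> direct_consequence S (All x B).

Definition deduction (K : theory) (G : set (wff K)) (B : wff K)
    (Bs : seq (wff K)) : Prop :=
  (exists Bs', Bs = rcons Bs' B) /\
  forall Bs1 C Bs2, Bs = Bs1 ++ C :: Bs2 ->
    [\/ axiom C, G C | direct_consequence [set D | List.In D Bs1] C].

Definition deducible (K : theory) (G : set (wff K)) (B : wff K) : Prop :=
  exists Bs, deduction G B Bs.

Definition consistent (K : theory) (G : set (wff K)) : Prop :=
  ~ exists C, deducible G C /\ deducible G (Neg C).

(* Recursive functions: the recursion and restricted least-number rules are   *)
(* stated by their defining equations, so that the class is closed under      *)
(* extensional equality.  The zero function is taken at every arity so that   *)
(* the recursion rule with no parameters may start from any constant.         *)
Inductive recursive : forall n, (n.-tuple nat -> nat) -> Prop :=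
| recursive_zero n : recursive (fun _ : n.-tuple nat => 0)
| recursive_succ : recursive (fun v : 1.-tuple nat => (thead v).+1)
| recursive_proj n (i : 'I_n) : recursive (fun v : n.-tuple nat => tnth v i)
| recursive_subst m n (g : m.-tuple nat -> nat)
    (h : 'I_m -> n.-tuple nat -> nat) :
    recursive g -> (forall i, recursive (h i)) ->
    recursive (fun v => g [tuple h i v | i < m])
| recursive_rec n (g : n.-tuple nat -> nat) (h : n.+2.-tuple nat -> nat)
    (f : n.+1.-tuple nat -> nat) :
    recursive g -> recursive h ->
    (forall v : n.-tuple nat, f [tuple of rcons v 0] = g v) ->
    (forall (v : n.-tuple nat) y, f [tuple of rcons v y.+1] =
       h [tuple of rcons (rcons v y) (f [tuple of rcons v y])]) ->
    recursive f
| recursive_mu n (g : n.+1.-tuple nat -> nat) (f : n.-tuple nat -> nat) :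
    recursive g ->
    (forall v : n.-tuple nat, g [tuple of rcons v (f v)] = 0) ->
    (forall (v : n.-tuple nat) y, y < f v -> g [tuple of rcons v y] <> 0) ->
    recursive f.

(* Effective computability is an informal notion, hence a parameter here: the *)
(* thesis is the assertion that it coincides with recursiveness.              *)
Definition Church_thesis
    (effectively_computable : forall n, (n.-tuple nat -> nat) -> Prop) : Prop :=
  forall n (f : n.-tuple nat -> nat),
    effectively_computable n f <-> recursive f.

(* B is shown to be deducible from G on the assumption that G is consistent,  *)
(* possibly by refuting that no deduction exists, so that none is exhibited.  *)
Definition established_metamathematically
    (K : theory) (G : set (wff K)) (B : wff K) : Prop :=
  consistent G -> ~ ~ deducible G B.

(* Main.v *)
Require Import Defs.
From mathcomp Require Import all_boot.
From mathcomp Require Import boolp classical_sets cardinality.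
Set Implicit Arguments.
Unset Strict Implicit.
Unset Printing Implicit Defensive.
Local Open Scope classical_set_scope.

(** The first claim is the deduction theorem.  Deducibility from a set of
    formulas is the smallest property that holds of the axioms and of that set
    and is closed under both rules, so one may argue by induction on how [C] is
    deduced from [T] and [A], showing [A => C] deducible from [T] alone
    ([deduction_theorem]).  The first two axiom schemas carry this past axioms,
    hypotheses and modus ponens; the fifth moves a generalisation inside
    [A => _], and this is where it matters that no variable is free in [A].

    For the second claim, either [(T, A)] is consistent or it is not.  If it is,
    the metamathematical argument applies, and classically a deduction that
    cannot fail to exist does exist.  If it is not, every formula is deducible
    from [(T, A)], in particular [B] ([deducible_inconsistent]).  In both cases
    [B] is deducible from [(T, A)], and the first claim applies. *)

Definition justified (K : theory) (G : set (wff K)) (Bs : seq (wff K))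
    (C : wff K) : Prop :=
  [\/ Defs.axiom C, G C | direct_consequence [set D | List.In D Bs] C].

Definition all_justified (K : theory) (G : set (wff K)) (Bs : seq (wff K)) :=
  forall Bs1 C Bs2, Bs = Bs1 ++ C :: Bs2 -> justified G Bs1 C.

Lemma direct_consequence_sub (L : language) (S S' : set (wff L)) (C : wff L) :
  S `<=` S' -> direct_consequence S C -> direct_consequence S' C.
Proof.
move=> sub [B D /sub SB /sub SBD|x B /sub SB].
  exact: modus_ponens SB SBD.
exact: generalisation.
Qed.

Lemma In_rcons (T : Type) (s : seq T) (x y : T) :
  List.In y (rcons s x) <-> List.In y s \/ y = x.
Proof.
rewrite -cats1; split.
  by move=> /List.in_app_iff[|[->|[]]]; [left|right].
case=> [ys|->].
  by apply/List.in_app_iff; left.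
by apply/List.in_app_iff; right; left.
Qed.

(** Deductions grow at the right end, so this is the form in which the
    condition on prefixes lends itself to induction. *)
Lemma all_justified_rcons (K : theory) (G : set (wff K)) Bs C :
  all_justified G (rcons Bs C) <-> all_justified G Bs /\ justified G Bs C.
Proof.
split=> [H|[H HC] Bs1 D Bs2].
  split=> [Bs1 D Bs2 e|]; last by apply: (H Bs C [::]); rewrite cats1.
  by apply: (H Bs1 D (rcons Bs2 C)); rewrite e rcons_cat.
case/lastP: Bs2 => [|Bs2 E].
  by rewrite cats1 => /rcons_inj[<- <-].
by rewrite -rcons_cons -rcons_cat => /rcons_inj[/H].
Qed.

Lemma all_justified_cat (K : theory) (G : set (wff K)) Bs Cs :
  all_justified G Bs -> all_justified G Cs -> all_justified G (Bs ++ Cs).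
Proof.
move=> HBs; elim/last_ind: Cs => [|Cs C IH]; first by rewrite cats0.
move=> /all_justified_rcons[/IH HCs HC].
rewrite -rcons_cat; apply/all_justified_rcons; split=> //.
case: HC => [ax|GC|dc]; [exact: Or31|exact: Or32|apply: Or33].
apply: direct_consequence_sub dc => D /= DCs.
by apply/List.in_app_iff; right.
Qed.

Lemma deducible_justified (K : theory) (G : set (wff K)) Bs C :
  all_justified G Bs -> justified G Bs C -> deducible G C.
Proof.
move=> HBs HC; exists (rcons Bs C); split; first by exists Bs.
by apply/all_justified_rcons.
Qed.

Lemma deducible_axiom (K : theory) (G : set (wff K)) C :
  Defs.axiom C -> deducible G C.
Proof.
by move=> ax; apply: (@deducible_justified K G [::]); [case|exact: Or31].
Qed.

Lemma deducible_hyp (K : theory) (G : set (wff K)) C : G C -> deducible G C.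
Proof.
by move=> GC; apply: (@deducible_justified K G [::]); [case|exact: Or32].
Qed.

Lemma deducible_mp (K : theory) (G : set (wff K)) B C :
  deducible G B -> deducible G (Imp B C) -> deducible G C.
Proof.
move=> [Bs [[Bs' eBs] HBs]] [Cs [[Cs' eCs] HCs]].
apply: (@deducible_justified K G (Bs ++ Cs)); first exact: all_justified_cat.
apply/Or33/(@modus_ponens _ _ B) => /=; apply/List.in_app_iff; [left|right].
  by rewrite eBs; apply/In_rcons; right.
by rewrite eCs; apply/In_rcons; right.
Qed.

Lemma deducible_gen (K : theory) (G : set (wff K)) x B :
  deducible G B -> deducible G (All x B).
Proof.
move=> [Bs [[Bs' eBs] HBs]]; apply: (deducible_justified HBs).
by apply/Or33/generalisation; rewrite eBs; apply/In_rcons; right.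
Qed.

(** With the four closure properties above, this makes deducibility the
    smallest set of formulas containing the axioms and [G] and closed under the
    rules; sequences of formulas can be forgotten from here on. *)
Lemma deducible_ind (K : theory) (G P : set (wff K)) :
  @Defs.axiom K `<=` P -> G `<=` P ->
  (forall B C, P B -> P (Imp B C) -> P C) ->
  (forall x B, P B -> P (All x B)) ->
  deducible G `<=` P.
Proof.
move=> Pax PG Pmp Pgen B [_ [[Bs ->]]].
suff H Cs : all_justified G Cs -> forall C, List.In C Cs -> P C.
  by move/H; apply; apply/In_rcons; right.
elim/last_ind: Cs => [_ C []|Cs D IH] /all_justified_rcons[/IH HCs HD] C.
case/In_rcons=> [/HCs//|->].
case: HD => [/Pax//|/PG//|[E F /HCs PE /HCs PEF|x E /HCs PE]].
  exact: Pmp PE PEF.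
exact: Pgen.
Qed.

Lemma deducible_logical (K : theory) (G : set (wff K)) (C : wff K) :
  logical_axiom C -> deducible G C.
Proof. by move=> ax; apply: deducible_axiom; left. Qed.

Lemma deducible_weaken (K : theory) (G : set (wff K)) (A C : wff K) :
  deducible G C -> deducible G (Imp A C).
Proof.
by move/deducible_mp; apply; apply: deducible_logical; exact: logical_axiom1.
Qed.

Lemma deducible_imp_mp (K : theory) (G : set (wff K)) (A B C : wff K) :
  deducible G (Imp A B) -> deducible G (Imp A (Imp B C)) ->
  deducible G (Imp A C).
Proof.
move=> AB ABC; apply: deducible_mp AB (deducible_mp ABC _).
by apply: deducible_logical; exact: logical_axiom2.
Qed.

Lemma deducible_imp_refl (K : theory) (G : set (wff K)) (A : wff K) :
  deducible G (Imp A A).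
Proof.
by apply: (@deducible_imp_mp _ _ _ (Imp A A)); apply: deducible_logical;
  exact: logical_axiom1.
Qed.

Lemma deducible_imp_gen (K : theory) (G : set (wff K)) x (A C : wff K) :
  ~~ free x A -> deducible G (Imp A C) -> deducible G (Imp A (All x C)).
Proof.
move=> xA /(deducible_gen x)/deducible_mp; apply.
by apply: deducible_logical; exact: logical_axiom5.
Qed.

(** The third axiom schema is reductio ad absurdum: a contradiction refutes
    [Neg B] once both of its halves are weakened by that hypothesis. *)
Lemma deducible_inconsistent (K : theory) (G : set (wff K)) (B : wff K) :
  ~ consistent G -> deducible G B.
Proof.
move=> /contrapT[C [HC HnC]].
apply: deducible_mp (deducible_weaken (Neg B) HC) _.
apply: deducible_mp (deducible_weaken (Neg B) HnC) _.
by apply: deducible_logical; exact: logical_axiom3.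
Qed.

Lemma deduction_theorem (K : theory) (T : set (wff K)) (A B : wff K) :
  closed_wff A -> deducible (T `|` [set A]) B -> deducible T (Imp A B).
Proof.
move=> closedA.
apply: (@deducible_ind K _ [set C | deducible T (Imp A C)]) => /=.
- by move=> C ax; exact/deducible_weaken/deducible_axiom.
- move=> C [TC|->]; last exact: deducible_imp_refl.
  exact/deducible_weaken/deducible_hyp.
- by move=> C D; exact: deducible_imp_mp.
- by move=> x C; exact/deducible_imp_gen/closedA.
Qed.

Theorem corollary1p2
  (effectively_computable : forall n : nat, (n.-tuple nat -> nat) -> Prop)
  (CT : Church_thesis effectively_computable)
  (K : theory) (T : set (wff K)) (finT : finite_set T)
  (A B : wff K) (closedA : closed_wff A) (closedB : closed_wff B) :
  (deducible (T `|` [set A]) B -> deducible T (Imp A B)) /\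
  (established_metamathematically (T `|` [set A]) B -> deducible T (Imp A B)).
Proof.
split=> [|established]; first exact: deduction_theorem.
apply: deduction_theorem => //.
have [con|] := pselect (consistent (T `|` [set A])).
  by apply: contrapT; exact: established.
exact: deducible_inconsistent.
Qed.
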